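(* Let $M$ be a ${\rm II}_1$-factor acting on $H=L^2(M,\tau)$ and let $\phi_1,\phi_2,\dots,\phi_N\in G$ be finitely many elements such that $\phi_i\circ\phi_j=\phi_j\circ\phi_i$ for all $i,j$. For any positive numbers $\{\lambda_j\}_{j=1}^N$ with $\sum_{j=1}^N\lambda_j=1$, set $\phi=\sum_{j=1}^N\lambda_j\phi_j$. Then $$\bigcap_{j=1}^N B(H)^{\phi_j}=B(H)^\phi.$$
   Context: $\tau$ is the unique tracial state of $M$, $\xi_0\in H=L^2(M,\tau)$ is the cyclic trace unit vector, and $J$ is the modular conjugation on $H$, $Jx\xi_0=x^*\xi_0$ for $x\in M$. For $a\in B(H)$, $\mathrm{Ad}\,a(T)=aTa^*$. Infinite sums are in the strong operator topology (pointwise for sums of maps). $\mathfrak S$ is the set of sequences $\{z_n\}_{n=1}^\infty$ in $M$ with $\sum_n z_nz_n^*=\sum_n z_n^*z_n=1$ such that for each $n$ there is $k$ with $z_n^*=z_k$. $G$ is the set of maps on $B(H)$ of the form $\phi=\sum_{n=1}^\infty\mathrm{Ad}\,Jz_nJ$, i.e. $\phi(T)=\sum_n Jz_nJ\,T\,Jz_n^*J$, with $\{z_n\}_{n=1}^\infty\in\mathfrak S$; these are unital normal completely positive maps. For a map $\theta$ on $B(H)$, $B(H)^\theta=\{T\in B(H):\theta(T)=T\}$. *)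

(* Defs.v *)
From HB Require Import structures.
From mathcomp Require Import all_boot all_order all_algebra.
From mathcomp Require Import all_classical all_reals all_analysis.
From mathcomp Require Export complex.

Set Implicit Arguments.
Unset Strict Implicit.
Unset Printing Implicit Defensive.

Import Order.TTheory GRing.Theory Num.Theory.
Import numFieldNormedType.Exports.

Local Open Scope classical_set_scope.
Local Open Scope ring_scope.

Section BoundedOperators.
Context {R : realType} (H : normedModType R[i]).

Definition bounded_linear : {pred H -> H} := mem [set T : H -> H |
  linear T /\ exists2 C : R[i], 0 <= C & forall x, `|T x| <= C * `|x|].

Record bop := BOp { bop_fun :> H -> H ; bop_subproof : bop_fun \in bounded_linear }.

HB.instance Definition _ := [isSub for bop_fun].
HB.instance Definition _ := [Choice of bop by <:].

Lemma bopP (S T : bop) : S =1 T -> S = T.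
Proof. by move=> ST; apply/val_inj/funext. Qed.

Lemma bounded_linearP (T : H -> H) : reflect
  (linear T /\ exists2 C : R[i], 0 <= C & forall x, `|T x| <= C * `|x|)
  (T \in bounded_linear).
Proof. by apply: (iffP idP); rewrite inE. Qed.

Lemma bop_linear (T : bop) : linear T.
Proof. by have /bounded_linearP[] := bop_subproof T. Qed.

Lemma bop_bounded (T : bop) :
  exists2 C : R[i], 0 <= C & forall x, `|T x| <= C * `|x|.
Proof. by have /bounded_linearP[] := bop_subproof T. Qed.

HB.instance Definition _ (T : bop) :=
  GRing.isLinear.Build R[i] H H *:%R T (bop_linear T).

Lemma bounded_linear_submod : submod_closed bounded_linear.
Proof.
split=> [|a S T /bounded_linearP[linS [C C0 leC]] /bounded_linearP[linT [D D0 leD]]];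
    apply/bounded_linearP; split.
- by move=> a x y; rewrite /= scaler0 addr0.
- by exists 0 => // x; rewrite mul0r normr0.
- move=> b x y; have -> z : (a *: S + T) z = a *: S z + T z by [].
  rewrite linS linT !scalerDr !scalerA [a * b]mulrC.
  by rewrite -!addrA; congr (_ + _); rewrite addrCA.
- exists (`|a| * C + D) => [|x]; first by rewrite addr_ge0// mulr_ge0.
  have -> : (a *: S + T) x = a *: S x + T x by [].
  rewrite mulrDl (le_trans (ler_normD _ _))// lerD// normrZ -mulrA.
  exact: ler_wpM2l.
Qed.

HB.instance Definition _ := GRing.isSubmodClosed.Build _ _ bounded_linear
  bounded_linear_submod.
HB.instance Definition _ := [SubChoice_isSubLmodule of bop by <:].

Lemma bounded_linear_id : id \in bounded_linear.
Proof.
by apply/bounded_linearP; split=> //; exists 1 => // x; rewrite mul1r.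
Qed.

Lemma bounded_linear_comp (S T : bop) : S \o T \in bounded_linear.
Proof.
apply/bounded_linearP; split=> [a x y|]; first by rewrite /= !linearP.
have [[C C0 leC] [D D0 leD]] := (bop_bounded S, bop_bounded T).
exists (C * D) => [|x]; first exact: mulr_ge0.
by rewrite (le_trans (leC _))// -mulrA ler_wpM2l.
Qed.

Definition bop_one := BOp bounded_linear_id.
Definition bop_mul (S T : bop) := BOp (bounded_linear_comp S T).

Let bop_mulA : associative bop_mul.
Proof. by move=> S T U; apply: bopP. Qed.
Let bop_mul1l : left_id bop_one bop_mul.
Proof. by move=> T; apply: bopP. Qed.
Let bop_mul1r : right_id bop_one bop_mul.
Proof. by move=> T; apply: bopP. Qed.
Let bop_mulDl : left_distributive bop_mul +%R.
Proof. by move=> S T U; apply: bopP. Qed.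
Let bop_mulDr : right_distributive bop_mul +%R.
Proof. by move=> S T U; apply: bopP => x; exact: (raddfD S). Qed.

HB.instance Definition _ := GRing.Zmodule_isPzRing.Build bop
  bop_mulA bop_mul1l bop_mul1r bop_mulDl bop_mulDr.

End BoundedOperators.

Notation "''B' ( H )" := (bop H) (format "''B' ( H )") : type_scope.

Section StrongSums.
Context {R : realType} {H : normedModType R[i]}.

Definition sot_sum (u : nat -> H -> H) (S : H -> H) :=
  forall x, series (fun n => u n x) @ \oo --> S x.

Definition fixed_points (theta : 'B(H) -> 'B(H)) : set 'B(H) :=
  [set T | theta T = T].

End StrongSums.

Section TracialVonNeumannAlgebras.
Context {R : realType} {H : completeNormedModType R[i]}.
Variable ip : {dot H for @Num.conj R[i]}.

Definition hilbert_inner_product := forall x, ip x x = `|x| ^+ 2.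

Definition is_adjoint (S T : 'B(H)) := forall x y, ip (S x) y = ip x (T y).

(* On a Hilbert space the adjoint exists by the Riesz representation theorem
   and is unique, so the default value 0 is never taken. *)
Definition adj (T : 'B(H)) : 'B(H) := xget 0 [set S | is_adjoint T S].

Definition commutant (A : set 'B(H)) : set 'B(H) :=
  [set T | forall S, A S -> T * S = S * T].

Definition von_neumann_algebra (M : set 'B(H)) :=
  (forall x, M x -> exists2 y, M y & is_adjoint x y) /\
  commutant (commutant M) = M.

Definition factor (M : set 'B(H)) :=
  [/\ von_neumann_algebra M, (1 : 'B(H)) != 0 &
      M `&` commutant M = range (fun c : R[i] => c *: (1 : 'B(H)))].

Definition projection (p : 'B(H)) := p * p = p /\ adj p = p.

(* Murray-von Neumann: type II (no minimal projection) and finite identity. *)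
Definition II1_factor (M : set 'B(H)) :=
  [/\ factor M,
      (forall v, M v -> adj v * v = 1 -> v * adj v = 1) &
      forall p, M p -> projection p -> p != 0 ->
        exists q, [/\ M q, projection q, q * p = q, q != 0 & q != p]].

Definition tracial_state (M : set 'B(H)) (tau : 'B(H) -> R[i]) :=
  [/\ (forall a x y, M x -> M y -> tau (a *: x + y) = a * tau x + tau y),
      (forall x, M x -> 0 <= tau (adj x * x)),
      tau 1 = 1 &
      forall x y, M x -> M y -> tau (x * y) = tau (y * x)].

(* H is L^2(M, tau), that is, the GNS space of tau with M acting on the left
   and xi0 the class of 1.  This fixes (M, H, xi0) up to unitary equivalence. *)
Definition L2_representation (M : set 'B(H)) (tau : 'B(H) -> R[i]) (xi0 : H) :=
  (forall x y, M x -> M y -> ip (x xi0) (y xi0) = tau (adj y * x)) /\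
  dense [set (x : 'B(H)) xi0 | x in M].

(* J is the continuous conjugate-linear extension of x xi0 |-> x^* xi0; it is
   unique because M xi0 is dense. *)
Definition modular_conjugation (M : set 'B(H)) (xi0 : H) (J : H -> H) :=
  [/\ (forall (a : R[i]) x y, J (a *: x + y) = Num.conj a *: J x + J y),
      continuous J &
      forall x, M x -> J (x xi0) = adj x xi0].

Definition frakS (M : set 'B(H)) (z : nat -> 'B(H)) :=
  [/\ (forall n, M (z n)),
      sot_sum (fun n => z n * adj (z n)) (1 : 'B(H)),
      sot_sum (fun n => adj (z n) * z n) (1 : 'B(H)) &
      forall n, exists k, adj (z n) = z k].

Definition Jconj (J : H -> H) (z : 'B(H)) : H -> H := J \o z \o J.

Definition frakG (M : set 'B(H)) (J : H -> H) : set ('B(H) -> 'B(H)) :=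
  [set phi | exists2 z, frakS M z & forall T : 'B(H),
    sot_sum (fun n => Jconj J (z n) \o T \o Jconj J (adj (z n))) (phi T)].

End TracialVonNeumannAlgebras.

(* Main.v *)
(** Each [phi j] is a numerical contraction: if [Re <T a, b> <= c (|a|^2 + |b|^2)]
    for all [a], [b], the same holds for [phi j T], because [J] is an isometric
    involution and [\sum z_n z_n^* = 1].  The claim then only uses that the
    [phi j] are commuting linear contractions.  Let [S] be the average, [S x = x],
    [y = P x - x] with [P = phi j], and let [alpha] be the norm of [y].  Choose a
    functional [f] with [f y] close to [alpha].  All [P^k y] are [S]-fixed of norm
    at most [alpha], and [f (P^k y)] is an average, with weight [lambda j] on
    [f (P^(k+1) y)], of numbers at most [alpha]; hence [f (P^k y)] stays close to
    [alpha] for [k < K].  But [\sum_(k < K) f (P^k y) = f (P^K x - x)] is bounded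
    uniformly in [K], so [alpha = 0]. *)
Require Import Defs.
From mathcomp Require Import all_boot all_order all_algebra.
From mathcomp Require Import all_classical all_reals all_analysis.
From mathcomp Require Import lra.
Import Order.TTheory GRing.Theory Num.Theory.
Import numFieldNormedType.Exports.
Local Open Scope classical_set_scope.
Local Open Scope complex_scope.
Local Open Scope ring_scope.

(** * Averages of commuting contractions *)

(* [forall i, f i v <= b * w i] plays the role of [|v| <= b]; the weights [w]
   make it unnecessary to normalise the functionals. *)
Lemma commuting_contractions_average_fixed (R : realType) (V : zmodType)
    (I : Type) (f : I -> V -> R) (w : I -> R) (N : nat)
    (P : 'I_N -> V -> V) (S : V -> V) (lambda : 'I_N -> R) (x : V) (c : R) :
  (forall i, {morph f i : u v / u - v}) -> (forall i, 0 <= w i) ->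
  (forall j, {morph P j : u v / u - v}) ->
  {morph S : u v / u - v} ->
  (forall j b v, (forall i, f i v <= b * w i) ->
    forall i, f i (P j v) <= b * w i) ->
  (forall j v, P j (S v) = S (P j v)) ->
  (forall i v, f i (S v) = \sum_(j < N) lambda j * f i (P j v)) ->
  (forall j, 0 < lambda j) -> \sum_(j < N) lambda j = 1 ->
  (forall i, `|f i x| <= c * w i) -> S x = x ->
  forall j i, f i (P j x - x) <= 0.
Proof.
move=> fB w0 PB SB Pcontr PS fS lam0 lam1 xc Sx j i.
pose y k := iter k (P j) (P j x - x).
have xcn k l : `|f l (iter k (P j) x)| <= c * w l.
  (* [Pcontr] is one-sided; the lower bound comes from applying it to [- v]. *)
  have bnd v : (forall m, `|f m v| <= c * w m) ->
      forall m, `|f m (P j v)| <= c * w m.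
    move=> vc m; rewrite ler_norml; apply/andP; split; last first.
      by apply: Pcontr => p; apply: le_trans (ler_norm _) (vc p).
    have f0 p : f p 0 = 0 by rewrite -(subrr 0) fB subrr.
    have P0 : P j 0 = 0 by rewrite -{1}(subrr 0) PB subrr.
    have -> : f m (P j v) = - f m (P j (- v)).
      by rewrite -[- v]sub0r PB P0 sub0r -[in RHS]sub0r fB f0 sub0r opprK.
    rewrite lerN2; apply: Pcontr => p.
    by rewrite -[- v]sub0r fB f0 sub0r (le_trans (ler_norm _))// normrN.
  by elim: k l => //= k IH l; exact: bnd.
have yE k : y k = iter k.+1 (P j) x - iter k (P j) x.
  by rewrite /y; elim: k => //= k ->; rewrite PB.
have Sy k : S (y k) = y k.
  have SPx l : S (iter l (P j) x) = iter l (P j) x.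
    by elim: l => //= l IH; rewrite -PS IH.
  by rewrite yE SB !SPx.
(* The infimum [a] of [E] is the norm of [y 0 = P j x - x] relative to the weights. *)
pose E := [set b : R | 0 <= b /\ forall m, f m (y 0%N) <= b * w m].
have E0 : E !=set0.
  exists (2 * `|c|); split; first by rewrite mulr_ge0.
  move=> m; rewrite yE fB /= (le_trans (ler_norm _))//.
  rewrite (le_trans (ler_normB _ _))// -mulrA mulr_natl mulr2n lerD//.
    by rewrite (le_trans (xcn 1%N m))// ler_wpM2r// ler_norm.
  by rewrite (le_trans (xcn 0%N m))// ler_wpM2r// ler_norm.
have lbE : lbound E 0 by move=> b [].
have hlE : has_lbound E by exists 0.
set a := inf E.
have a0 : 0 <= a by apply: lb_le_inf.
have ya m : f m (y 0%N) <= a * w m.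
  apply/ler_addgt0Pr => e e0.
  (* Adding 1 to [w m] covers the case [w m = 0]. *)
  have d0 : 0 < e / (w m + 1) by rewrite divr_gt0// ltr_wpDl.
  have [b [b0 Eb] ba] := inf_adherent d0 (conj E0 hlE).
  apply: le_trans (Eb m) _; apply: le_trans (ler_wpM2r (w0 m) (ltW ba)) _.
  rewrite mulrDl lerD2l -mulrA ler_piMr ?(ltW e0)// mulrC ler_pdivrMr ?ltr_wpDl//.
  by rewrite mul1r lerDl.
have ykla k m : f m (y k) <= a * w m.
  by elim: k m => // k IH m; exact: Pcontr.
have [a_le0|a_gt0] := leP a 0.
  by rewrite (le_trans (ya i))// mulr_le0_ge0.
exfalso.
have lamle k : lambda k <= 1.
  by rewrite -lam1 (bigD1 k)//= lerDl sumr_ge0// => l _; exact: ltW.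
(* Since [y k] is fixed by [S], the deficit on the right is the [lambda]-average of the deficits of
   all [P l (y k)]. These are nonnegative, and only the term [l = j] is kept. *)
have step m k : lambda j * (a * w m - f m (y k.+1)) <= a * w m - f m (y k).
  rewrite -[in leRHS](Sy k) fS -[X in _ <= X - _]mul1r -lam1 mulr_suml -sumrB.
  rewrite (bigD1 j)//= -mulrBr lerDl sumr_ge0// => l _.
  by rewrite -mulrBr mulr_ge0 ?subr_ge0 ?Pcontr// ltW.
have iter_step m k : lambda j ^+ k * (a * w m - f m (y k)) <= a * w m - f m (y 0%N).
  elim: k => [|k IH]; first by rewrite expr0 mul1r.
  by apply: le_trans IH; rewrite exprSr -mulrA ler_wpM2l// exprn_ge0// ltW.
have cK (K : nat) : K%:R * a <= 4 * `|c|.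
  (* By [iter_step], a deficit below [e * w m] at [y 0] gives one of at most [a / 2 * w m] at every
     [y k] with [k < K]. Telescoping then yields [K * (a / 2) <= 2 * |c|]. *)
  pose e := a * lambda j ^+ K / 2.
  have lK0 : 0 < lambda j ^+ K by rewrite exprn_gt0.
  have e0 : 0 < e by rewrite divr_gt0// mulr_gt0.
  have lK1 : lambda j ^+ K <= 1 by rewrite exprn_ile1// ltW.
  have ea : e < a by rewrite /e; nra.
  (* Otherwise [a - e] would be an element of [E] below its infimum. *)
  have [m am] : exists m, (a - e) * w m < f m (y 0%N).
    apply/not_existsP => H; suff : a <= a - e by rewrite leNgt ltrBlDr ltrDl e0.
    apply: ge_inf => //; split; first by rewrite subr_ge0 ltW.
    by move=> m; rewrite leNgt; apply/negP/H.
  have wm : 0 < w m.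
    rewrite lt_neqAle w0 andbT; apply/eqP => wm0.
    by move: (ya m) am; rewrite -wm0 !mulr0; case: ltgtP.
  have tele : \sum_(k < K) f m (y k) = f m (iter K (P j) x) - f m x.
    rewrite -(big_mkord xpredT (fun k => f m (y k))).
    by rewrite (telescope_sumr_eq (fun k => f m (iter k (P j) x)))// => k _; rewrite yE fB.
  have low (k : 'I_K) : a / 2 * w m <= f m (y k).
    have lk0 : 0 < lambda j ^+ k by rewrite exprn_gt0.
    have lKk : lambda j ^+ K <= lambda j ^+ k.
      by rewrite ler_wiXn2l ?lamle ?(ltW (lam0 _))// ltnW.
    have : lambda j ^+ k * (a * w m - f m (y k)) <= lambda j ^+ k * (a / 2 * w m).
      rewrite (le_trans (iter_step m k))// (@le_trans _ _ (e * w m))//.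
        by rewrite lerBlDl -lerBlDr -mulrBl ltW.
      by rewrite mulrA ler_wpM2r// /e [leLHS]mulrAC mulrC ler_wpM2r// divr_ge0.
    by rewrite ler_pM2l// lerBlDr -lerBlDl; apply: le_trans; nra.
  have : \sum_(k < K) a / 2 * w m <= 2 * `|c| * w m.
    rewrite (le_trans (ler_sum _ (fun k _ => low k)))// tele.
    rewrite (le_trans (ler_norm _))// (le_trans (ler_normB _ _))//.
    have := xcn K m; have := xcn 0%N m => /=.
    have : c * w m <= `|c| * w m by rewrite ler_wpM2r// ler_norm.
    by lra.
  rewrite sumr_const card_ord -[leLHS]mulr_natl mulrA ler_pM2r// => h; lra.
have := cK (Num.bound (4 * `|c| / a)).
have : 4 * `|c| / a < (Num.bound (4 * `|c| / a))%:R.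
  by rewrite archi_boundP// divr_ge0// ?mulr_ge0// ltW.
by rewrite ltr_pdivrMr//; case: ltgtP.
Qed.

(** Extends identities about [J] from the dense set [M xi0] to [H]. *)
Lemma dense_eq {K : numFieldType} {V : pseudoMetricNormedZmodType K}
    {W : topologicalType} {D : set W} {f g : W -> V} :
  dense D -> continuous f -> continuous g -> {in D, f =1 g} -> f =1 g.
Proof.
move=> dD fc gc fg x; apply/eqP/negP => fgx.
have : open [set y | f y - g y != 0].
  have -> : [set y | f y - g y != 0] = (fun y => f y - g y) @^-1` (~` [set 0]).
    by apply/seteqP; split => y /= /eqP.
  apply: open_comp; last first.
    apply: closed_openC.
    exact: (accessible_closed_set1 (hausdorff_accessible (@norm_hausdorff _ V))).
  by move=> y _; apply: cvgB; [exact: fc|exact: gc].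
move=> /dD [|y [/= fgy Dy]]; first by exists x; rewrite /= subr_eq0; apply/negP.
by move: fgy; rewrite fg ?inE// subrr eqxx.
Qed.

(** * The real part of the inner product *)

Section RealInnerProduct.
Context {R : realType} {H : completeNormedModType R[i]}.
Context {ip : {dot H for @Num.conj R[i]}}.
Hypothesis ip_norm : hilbert_inner_product ip.
Implicit Types (a b c : H) (r : R).

(** The real part is ordered, still separates operators ([bop_ext]), and is preserved by the
    conjugate-linear [J]. *)
Definition re_ip a b : R := complex.Re (ip a b).

Lemma Re_add (x y : R[i]) : complex.Re (x + y) = complex.Re x + complex.Re y.
Proof. by case: x y => [? ?] []. Qed.

Lemma Re_opp (x : R[i]) : complex.Re (- x) = - complex.Re x.
Proof. by case: x. Qed.

Lemma re_ipBl a b c : re_ip (a - b) c = re_ip a c - re_ip b c.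
Proof. by rewrite /re_ip linearBl Re_add Re_opp. Qed.

Lemma re_ipDl a b c : re_ip (a + b) c = re_ip a c + re_ip b c.
Proof. by rewrite /re_ip linearDl Re_add. Qed.

Lemma re_ip0l c : re_ip 0 c = 0.
Proof. by rewrite /re_ip linear0l. Qed.

Lemma re_ipZl r a b : re_ip (r%:C *: a) b = r * re_ip a b.
Proof.
rewrite /re_ip linearZl_LR /=.
by case: (ip a b) => x y; rewrite /= mul0r subr0.
Qed.

Lemma re_ip_suml N (F : 'I_N -> H) b :
  re_ip (\sum_i F i) b = \sum_i re_ip (F i) b.
Proof.
exact: (big_morph (re_ip^~ b) (fun x y => re_ipDl x y b) (re_ip0l b)).
Qed.

Lemma re_ipC a b : re_ip a b = re_ip b a.
Proof.
have Re_conj (z : R[i]) : complex.Re (Num.conj z) = complex.Re z.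
  by rewrite -[Num.conj z]/(z^*%C); case: z.
by rewrite /re_ip hermC expr0 mul1r Re_conj.
Qed.

Lemma re_ipNr a b : re_ip a (- b) = - re_ip a b.
Proof. by rewrite -[- b]sub0r re_ipC re_ipBl re_ip0l sub0r re_ipC. Qed.

Lemma re_ipE a : (re_ip a a)%:C = `|a| ^+ 2.
Proof. by rewrite /re_ip ip_norm RRe_real// realX. Qed.

Lemma re_ip_ge0 a : 0 <= re_ip a a.
Proof. by rewrite -ler0c re_ipE exprn_ge0. Qed.

Lemma re_ip_eq0 a : re_ip a a = 0 -> a = 0.
Proof.
by move=> a0; apply/eqP; rewrite -normr_eq0 -sqrf_eq0 -re_ipE a0.
Qed.

Lemma re_ip_sqrB a b :
  re_ip (a - b) (a - b) = re_ip a a - 2 * re_ip a b + re_ip b b.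
Proof.
by rewrite re_ipBl !(re_ipC _ (a - b)) !re_ipBl (re_ipC b a); lra.
Qed.

Lemma re_ip_polar a b :
  2 * re_ip a b = re_ip a a + re_ip b b - re_ip (a - b) (a - b).
Proof. by rewrite re_ip_sqrB; lra. Qed.

Lemma re_ip_le a b : 2 * re_ip a b <= re_ip a a + re_ip b b.
Proof. by rewrite re_ip_polar gerBl re_ip_ge0. Qed.

Lemma cvg_re_ip {u : nat -> H} {a} b :
  u @ \oo --> a -> (fun n => re_ip (u n) b) @ \oo --> re_ip a b.
Proof.
move=> ua; apply/cvgrPdist_lt => e e0.
pose q := re_ip b b + 1.
have q0 : 0 < q by rewrite ltr_wpDl// re_ip_ge0.
have d0 : 0 < (e / q)%:C :> R[i] by rewrite ltcR divr_gt0.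
move/cvgrPdist_lt : ua => /(_ _ d0); apply: filterS => n an.
have ann : re_ip (a - u n) (a - u n) < (e / q) ^+ 2.
  rewrite -ltcR re_ipE rmorphXn /=.
  by rewrite ltrXn2r// ?nnegrE// ltW.
rewrite -re_ipBl; move: (a - u n) ann => v vv.
(* Scaled arithmetic-geometric mean in place of Cauchy-Schwarz: with [r = q / e] or its negative,
   [r v] has norm at most 1, so [2 r <v, b> <= 1 + |b|^2 = q]. *)
have key r : r ^+ 2 = (q / e) ^+ 2 -> r * re_ip v b < q.
  move=> rE; have := re_ip_le (r%:C *: v) b.
  rewrite !re_ipZl (re_ipC v (_ *: v)) re_ipZl.
  have : r ^+ 2 * re_ip v v <= 1.
    by rewrite rE -ler_pdivlMl ?exprn_gt0 ?divr_gt0// mulr1 -exprVn invf_div ltW.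
  by have := re_ip_ge0 b; rewrite /q; nra.
have qe0 : 0 < q / e by rewrite divr_gt0.
have qeE : q / e * e = q by rewrite divfK// gt_eqF.
rewrite ltr_norml ltrNl; apply/andP; split; rewrite -(ltr_pM2l qe0) qeE.
  by rewrite mulrN -mulNr key// sqrrN.
exact: key.
Qed.

Lemma bop_ext (S T : 'B(H)) :
  (forall a b, re_ip (S a) b = re_ip (T a) b) -> S = T.
Proof.
move=> ST; apply: bopP => a; apply/eqP; rewrite -subr_eq0; apply/eqP/re_ip_eq0.
by rewrite re_ipBl ST subrr.
Qed.

Lemma re_ip_series (u : nat -> H) n b :
  re_ip (series u n) b = series (fun k => re_ip (u k) b) n.
Proof.
rewrite /series /=.
exact: (big_morph (re_ip^~ b) (fun x y => re_ipDl x y b) (re_ip0l b)).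
Qed.

Lemma cvg_re_ip_series {u : nat -> H} {a} b :
  series u @ \oo --> a -> series (fun k => re_ip (u k) b) @ \oo --> re_ip a b.
Proof.
move=> /(cvg_re_ip b); apply: cvg_trans; apply: near_eq_cvg.
by apply: nearW => n; rewrite re_ip_series.
Qed.

(** Adjoints are unique, so the choice made in [adj] is forced. *)
Lemma adjP {S T : 'B(H)} : is_adjoint ip S T -> adj ip S = T.
Proof.
move=> ST; apply: xget_unique => // U SU; apply: bop_ext => a b.
by rewrite !(re_ipC _ b) /re_ip -SU ST.
Qed.

Lemma is_adjoint_sym {S T : 'B(H)} : is_adjoint ip S T -> is_adjoint ip T S.
Proof.
have ipC c d : ip c d = Num.conj (ip d c) by rewrite hermC expr0 mul1r.
by move=> ST a b; rewrite ipC -(ST b a) -ipC.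
Qed.

(** * The modular conjugation is an isometric involution *)

Context {M : set 'B(H)} {tau : 'B(H) -> R[i]} {xi0 : H} {J : H -> H}.
Hypothesis M_adj : forall x, M x -> exists2 y, M y & is_adjoint ip x y.
Hypothesis tau_trace : tracial_state ip M tau.
Hypothesis M_L2 : L2_representation ip M tau xi0.
Hypothesis J_conj : modular_conjugation ip M xi0 J.

Lemma modular_conjB : {morph J : a b / a - b}.
Proof.
move=> a b; have [JZ _ _] := J_conj.
by rewrite -[a - b]addrC -scaleN1r JZ rmorphN rmorph1 scaleN1r addrC.
Qed.

Lemma adj_mem {x : 'B(H)} : M x -> M (adj ip x) /\ is_adjoint ip x (adj ip x).
Proof. by move=> /M_adj[y My xy]; rewrite (adjP xy). Qed.

Lemma modular_conjK : involutive J.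
Proof.
have [JZ Jc JM] := J_conj; have [_ dM] := M_L2.
apply: (dense_eq dM).
- by move=> a; apply: continuous_comp; exact: Jc.
- by move=> a; exact: cvg_id.
move=> _ /set_mem[x Mx <-]; have [Mx' xx'] := adj_mem Mx.
by rewrite !JM// (adjP (is_adjoint_sym xx')).
Qed.

Lemma modular_conj_norm a : `|J a| = `|a|.
Proof.
have [JZ Jc JM] := J_conj; have [MM dM] := M_L2.
have [_ _ _ tauC] := tau_trace.
have JJ x : M x -> `|J (x xi0)| ^+ 2 = `|x xi0| ^+ 2.
  move=> Mx; have [Mx' xx'] := adj_mem Mx.
  rewrite JM// -!ip_norm !MM// (adjP (is_adjoint_sym xx')).
  exact: tauC.
move: a; apply: (dense_eq (f := Num.norm \o J) (g := Num.norm) dM).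
- by move=> c; apply: continuous_comp; [exact: Jc|exact: norm_continuous].
- exact: norm_continuous.
by move=> _ /set_mem[x Mx <-]; apply/eqP; rewrite -(@eqrXn2 _ 2)//= JJ.
Qed.

Lemma re_ip_modular_conj a b : re_ip (J a) (J b) = re_ip a b.
Proof.
apply: (mulfI (_ : 2 != 0)) => //; rewrite !re_ip_polar -modular_conjB.
have n c : re_ip (J c) (J c) = re_ip c c.
  by apply: complexI; rewrite !re_ipE modular_conj_norm.
by rewrite !n.
Qed.

(** An isometric involution is self-adjoint for the real form, so [J z^* J] is the adjoint of
    [J z J]. *)
Lemma re_ip_Jconj {z y : 'B(H)} a b : is_adjoint ip z y ->
  re_ip (Jconj J z a) b = re_ip a (Jconj J y b).
Proof.
move=> zy; rewrite /Jconj /= -{1}[b]modular_conjK re_ip_modular_conj.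
by rewrite /re_ip zy -/(re_ip _ _) -re_ip_modular_conj modular_conjK.
Qed.

(** * Elements of [frakG] are linear numerical contractions *)

Section FrakG.
Context {phi : 'B(H) -> 'B(H)} {z : nat -> 'B(H)}.
Hypothesis Sz : frakS ip M z.
Hypothesis phiE : forall T : 'B(H),
  sot_sum (fun n => Jconj J (z n) \o T \o Jconj J (adj ip (z n))) (phi T).

(** The [n]-th term of [<phi T a, b>] is [<T a_n, b_n>] with [a_n = J z_n^* J a] and
    [b_n = J z_n^* J b]. The hypothesis on [T] is applied termwise, then summed. *)
Lemma frakG_contraction (c : R) (T : 'B(H)) :
  (forall a b, re_ip (T a) b <= c * (re_ip a a + re_ip b b)) ->
  forall a b, re_ip (phi T a) b <= c * (re_ip a a + re_ip b b).
Proof.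
move=> Tc a b; have [Mz zz _ _] := Sz.
pose q a n := re_ip (Jconj J (adj ip (z n)) a) (Jconj J (adj ip (z n)) a).
(* Here [|J z_n^* J d|^2 = <z_n z_n^* J d, J d>], and the [z_n z_n^*] sum to 1. *)
have cvgq d : series (q d) @ \oo --> re_ip d d.
  have -> : re_ip d d = re_ip ((1 : 'B(H)) (J d)) (J d) by rewrite re_ip_modular_conj.
  have -> : q d = fun n => re_ip ((z n * adj ip (z n)) (J d)) (J d).
    apply/funext => n; have [_ zadj] := adj_mem (Mz n).
    rewrite /q /Jconj /= re_ip_modular_conj.
    by rewrite /re_ip -zadj.
  exact: cvg_re_ip_series _ (zz (J d)).
have cvgc : (fun n => c * (series (q a) n + series (q b) n)) @ \oo -->
    c * (re_ip a a + re_ip b b).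
  by apply: cvgM; [exact: cvg_cst|exact: cvgD].
apply: (ler_cvg_to (cvg_re_ip_series b (phiE T a)) cvgc).
apply: nearW => n; rewrite /series /= -big_split /= mulr_sumr ler_sum// => k _.
have [_ zadj] := adj_mem (Mz k).
by rewrite (re_ip_Jconj _ _ zadj).
Qed.

(** Scalars pass through [J] twice, so the two conjugations cancel. *)
Lemma frakG_linear : linear phi.
Proof.
have [JZ _ _] := J_conj.
move=> k S T; apply: bopP => a.
apply: (norm_cvg_unique (phiE (k *: S + T) a)).
change (series (fun n => Jconj J (z n) ((k *: S + T) (Jconj J (adj ip (z n)) a)))
  @ \oo --> k *: phi S a + phi T a).
apply: cvg_trans (cvgD (cvgZl_tmp (phiE S a)) (phiE T a)); apply: near_eq_cvg.
apply: nearW => n; rewrite /series fctE /= scaler_sumr -big_split /=; apply: eq_bigr => n' _.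
rewrite /Jconj /=; set b := J (adj _ _ _).
transitivity (J (z n' (J (k *: S b + T b)))) => //; rewrite JZ [z n' (_ + _)]linearP JZ.
by rewrite [Num.conj (Num.conj k)]conjcK.
Qed.
End FrakG.

End RealInnerProduct.

Arguments re_ip {R H} ip a b.

Theorem proposition3p4 (R : realType) (H : completeNormedModType R[i])
    (ip : {dot H for @Num.conj R[i]}) (ip_norm : hilbert_inner_product ip)
    (M : set 'B(H)) (tau : 'B(H) -> R[i]) (xi0 : H) (J : H -> H)
    (M_II1 : II1_factor ip M) (tau_trace : tracial_state ip M tau)
    (M_L2 : L2_representation ip M tau xi0)
    (J_conj : modular_conjugation ip M xi0 J)
    (N : nat) (phi : 'I_N -> 'B(H) -> 'B(H))
    (phi_G : forall j, frakG ip M J (phi j))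
    (phi_comm : forall i j, phi i \o phi j = phi j \o phi i)
    (lambda : 'I_N -> R) (lambda_gt0 : forall j, 0 < lambda j)
    (lambda_sum : \sum_(j < N) lambda j = 1) :
  \bigcap_(j in [set: 'I_N]) fixed_points (phi j) =
  fixed_points (fun T => \sum_(j < N) (lambda j)%:C *: phi j T).
Proof.
have [[[M_adj _] _ _] _ _] := M_II1.
have phi_lin j : linear (phi j).
  by have [z _ /(frakG_linear J_conj)] := phi_G j.
have phiB j : {morph phi j : S T / S - T}.
  by move=> S T; rewrite addrC -scaleN1r phi_lin scaleN1r addrC.
have phi0 j : phi j 0 = 0 by rewrite -{1}(subrr 0) phiB subrr.
have phiD j : {morph phi j : S T / S + T}.
  by move=> S T; rewrite -[S]scale1r phi_lin !scale1r.
have phiZ j k T : phi j (k *: T) = k *: phi j T.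
  by rewrite -[k *: T]addr0 phi_lin phi0 addr0.
have phi_sum j (F : 'I_N -> 'B(H)) : phi j (\sum_i F i) = \sum_i phi j (F i).
  exact: (big_morph (phi j) (phiD j) (phi0 j)).
set S := fun T => \sum_(j < N) _.
have lamC : \sum_(j < N) (lambda j)%:C = 1 :> R[i].
  by rewrite -(rmorph_sum (real_complex R)) lambda_sum.
apply/seteqP; split => T.
  move=> Tfix; rewrite /fixed_points /= /S.
  rewrite (eq_bigr (fun j => (lambda j)%:C *: T)).
    by rewrite -scaler_suml lamC scale1r.
  by move=> j _; congr (_ *: _); exact: Tfix.
move=> ST j _.
have bop_suml (F : 'I_N -> 'B(H)) a : (\sum_i F i) a = \sum_i F i a.
  by apply: (big_morph (fun U : 'B(H) => U a)).
(* The functionals are indexed by pairs of vectors, so bounds [f p U <= b * w p] are exactly those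
   that [frakG_contraction] preserves. *)
pose f (p : H * H) (U : 'B(H)) := re_ip ip (U p.1) p.2.
pose w (p : H * H) := re_ip ip p.1 p.1 + re_ip ip p.2 p.2.
have [C C0 TC] := bop_bounded T.
have T_le a : re_ip ip (T a) (T a) <= complex.Re C ^+ 2 * re_ip ip a a.
  have CE : C = (complex.Re C)%:C by rewrite RRe_real// ger0_real.
  rewrite -lecR rmorphM rmorphXn /= -CE !re_ipE// -exprMn.
  by rewrite ler_sqr ?nnegrE ?mulr_ge0// TC.
(* Large enough for [2 |Re <T a, b>| <= |T a|^2 + |b|^2 <= C^2 |a|^2 + |b|^2]; the two signs come
   from [b] and [- b]. *)
pose c := complex.Re C ^+ 2 + 1.
have fle (p : H * H) : `|f p T| <= c * w p.
  have := re_ip_ge0 ip_norm p.1; have := re_ip_ge0 ip_norm p.2.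
  have := T_le p.1; have := re_ip_le ip_norm (T p.1) p.2.
  have := re_ip_le ip_norm (T p.1) (- p.2).
  rewrite !re_ipNr (re_ipC (- _)) re_ipNr opprK.
  have C2 := sqr_ge0 (complex.Re C).
  have := mulr_ge0 C2 (re_ip_ge0 ip_norm p.1).
  have := mulr_ge0 C2 (re_ip_ge0 ip_norm p.2).
  by rewrite ler_norml /c /w /f !(mulrDl, mulrDr); lra.
have le0 := @commuting_contractions_average_fixed R _ _ f w N phi S lambda T c.
have phij_le p : f p (phi j T - T) <= 0.
  apply: le0 => //.
  - by move=> q U V; rewrite /f re_ipBl.
  - by move=> q; rewrite addr_ge0// re_ip_ge0.
  - move=> U V; rewrite /S -sumrB; apply: eq_bigr => k _.
    by rewrite phiB scalerBr.
  - move=> k b U Ub q; have [z Sz zE] := phi_G k.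
    apply: (frakG_contraction ip_norm M_adj tau_trace M_L2 J_conj Sz zE) => a b'.
    exact: (Ub (a, b')).
  - move=> k U; rewrite /S phi_sum; apply: eq_bigr => l _.
    rewrite phiZ; congr (_ *: _).
    exact: (congr1 (fun h => h U) (phi_comm k l)).
  - move=> q U; rewrite /f /S bop_suml re_ip_suml; apply: eq_bigr => k _.
    by rewrite re_ipZl.
(* Pairing [D a], where [D = phi j T - T], with itself turns the one-sided bound into
   [|D a|^2 <= 0]. *)
have D0 a : (phi j T - T) a = 0.
  apply: (re_ip_eq0 ip_norm); apply/eqP; rewrite eq_le re_ip_ge0// andbT.
  exact: (phij_le (a, (phi j T - T) a)).
apply: bopP => a; apply/eqP; rewrite -subr_eq0; apply/eqP.
exact: D0.
Qed.
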